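(* Let $n\ge 2$ and $k\ge 1$ be integers, let $f:\mathbb{R}_{>0}\to\mathbb{R}$ be an admissible force function, let $m_1,\dots,m_n>0$ be given masses and let $T(t)$ be a given admissible rotation matrix. Let $R_{T,m_1,\dots,m_n}$ be the set of all relative equilibria $\{T(t)Q_i\}_{i=1}^n$ (with rotation matrix $T(t)$ and masses $m_1,\dots,m_n$) of the generalised quasi-homogeneous $n$-body problem $$\ddot q_i=\sum_{j=1,\ j\ne i}^n m_j(q_j-q_i)f(\|q_j-q_i\|),\qquad i\in\{1,\dots,n\}.$$ Then there exists a constant $c\in\mathbb{R}_{>0}$ such that for all relative equilibria $\{T(t)Q_i\}_{i=1}^n$ in $R_{T,m_1,\dots,m_n}$ we have $\|Q_i-Q_j\|>c$ for all $i,j\in\{1,\dots,n\}$, $i\neq j$.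
   Context: $\|\cdot\|$ and $\langle\cdot,\cdot\rangle$ are the Euclidean norm and inner product on $\mathbb{R}^{k+1}$. Admissible force function: a continuous function $f:\mathbb{R}_{>0}\to\mathbb{R}$ such that $f(x)$ and $xf'(x)$ are bounded and differentiable for $x$ away from $0$ (i.e. for every $\delta>0$ both are differentiable and bounded on $(\delta,\infty)$), and $\lim_{x\downarrow 0}f(x)=\pm\infty$ (i.e. the limit is either $+\infty$ or $-\infty$). Admissible rotation matrix: a twice differentiable time-dependent invertible real $(k+1)\times(k+1)$ matrix $T(t)$ ($t$ in a nonempty open time interval) such that $\langle T(t)x,T(t)y\rangle=\langle x,y\rangle$ for all $x,y\in\mathbb{R}^{k+1}$ and all $t$, and such that there exist constants $c_1,c_2\in\mathbb{R}_{>0}$ with $c_1\|x\|\le\|T(t)^{-1}\ddot T(t)x\|\le c_2\|x\|$ for all $x\in\mathbb{R}^{k+1}$ and all $t$. Relative equilibrium with rotation matrix $T(t)$ and masses $m_1,\dots,m_n$: a solution $q_1(t),\dots,q_n(t)\in\mathbb{R}^{k+1}$ of the displayed system (in particular the $q_i(t)$ are pairwise distinct, so that the right-hand side is defined) of the form $q_i(t)=T(t)Q_i$, $i\in\{1,\dots,n\}$, with constant vectors $Q_1,\dots,Q_n\in\mathbb{R}^{k+1}$. *)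

(* Defs.v *)
From mathcomp Require Import all_boot all_order all_algebra.
From mathcomp Require Import all_classical all_reals all_analysis.
Set Implicit Arguments.
Unset Strict Implicit.
Unset Printing Implicit Defensive.
Import Order.TTheory GRing.Theory Num.Theory.
Import numFieldNormedType.Exports.
Local Open Scope classical_set_scope.
Local Open Scope ring_scope.

Definition edot (R : realType) (d : nat) (x y : 'cV[R]_d) : R :=
  \sum_(i < d) x i 0 * y i 0.

(* The library norm `|x| on matrices is the sup norm, which is not the norm
   meant here; it is used below only through the topology it induces. *)
Definition enorm (R : realType) (d : nat) (x : 'cV[R]_d) : R :=
  Num.sqrt (edot x x).

Definition open_time_interval (R : realType) (I : set R) : Prop :=
  [/\ open I, is_interval I & I !=set0].

(* Since I is open, the derivatives at points of I only depend on g over I. *)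
Definition twice_derivable_on (R : realType) (V : normedModType R)
    (I : set R) (g : R -> V) : Prop :=
  forall t, I t -> derivable g t 1 /\ derivable (derive1 g) t 1.

(* f is total on R; only its values on the positive reals are constrained. *)
Definition admissible_force (R : realType) (f : R -> R) : Prop :=
  [/\ forall x : R, 0 < x -> {for x, continuous f},
      forall delta : R, 0 < delta ->
        [/\ forall x : R, delta < x -> derivable f x 1,
            [bounded f x | x in [set x : R | delta < x]],
            forall x : R, delta < x -> derivable (fun y : R => y * derive1 f y : R) x 1 &
            [bounded x * derive1 f x | x in [set x : R | delta < x]]] &
      (f x @[x --> 0^'+] --> +oo) \/ (f x @[x --> 0^'+] --> -oo)].

Definition admissible_rotation (R : realType) (d : nat) (I : set R)
    (T : R -> 'M[R]_d) : Prop :=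
  [/\ twice_derivable_on I T,
      forall t, I t -> T t \in unitmx,
      forall t, I t -> forall x y : 'cV[R]_d,
        edot (T t *m x) (T t *m y) = edot x y &
      exists c1 c2 : R, [/\ 0 < c1, 0 < c2 &
        forall t, I t -> forall x : 'cV[R]_d,
          c1 * enorm x <= enorm (invmx (T t) *m derive1n 2 T t *m x)
                       <= c2 * enorm x]].

Definition nbody_solution (R : realType) (n d : nat) (f : R -> R)
    (m : 'I_n -> R) (I : set R) (q : 'I_n -> R -> 'cV[R]_d) : Prop :=
  [/\ forall t, I t -> forall i j, i != j -> q i t != q j t,
      forall i, twice_derivable_on I (q i) &
      forall t, I t -> forall i,
        derive1n 2 (q i) t =
        \sum_(j < n | j != i)
          (m j * f (enorm (q j t - q i t))) *: (q j t - q i t)].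

Definition relative_equilibria (R : realType) (n d : nat) (f : R -> R)
    (m : 'I_n -> R) (I : set R) (T : R -> 'M[R]_d) :
    set ('I_n -> R -> 'cV[R]_d) :=
  [set q | nbody_solution f m I q /\
           exists Q : 'I_n -> 'cV[R]_d,
             forall i t, I t -> q i t = T t *m Q i].

(* Main.v *)
(* At one instant t, the matrix A = T(t)^-1 T''(t) is bounded and the equations
   of motion become A Q_i = sum_j m_j g(Q_j - Q_i) with g(x) = f(|x|) x. Away
   from 0, g is Lipschitz because f(x) and x f'(x) are bounded there.
   Consider a cluster of bodies of diameter |u|, u = Q_i - Q_l, far from all
   other bodies. In <u, A u> = sum_j m_j <u, g(Q_j - Q_i) - g(Q_j - Q_l)> the
   bodies outside the cluster contribute O(|u|^2) by the Lipschitz bound, and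
   those inside contribute terms of one sign, by maximality of |u|, among which
   m_l f(|u|) |u|^2. Hence f(|u|) is bounded, and |u| cannot be too small.
   A ball around Q_i that is not isolated at a given scale loses a body when
   shrunk to the next scale, so after n scales it contains Q_i only. *)
Require Import Defs.
From mathcomp Require Import all_boot all_order all_algebra.
From mathcomp Require Import all_classical all_reals all_analysis.
From mathcomp Require Import ring lra.
Set Implicit Arguments.
Unset Strict Implicit.
Unset Printing Implicit Defensive.
Import Order.TTheory GRing.Theory Num.Theory.
Import numFieldNormedType.Exports.
Local Open Scope classical_set_scope.
Local Open Scope ring_scope.

(** * Euclidean inner product and norm on column vectors *)

Section Euclid.
Variables (R : realType) (d : nat).
Implicit Types x y z : 'cV[R]_d.

Lemma edotC x y : edot x y = edot y x.
Proof. by apply: eq_bigr => i _; rewrite mulrC. Qed.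

Lemma edotDr x y z : edot x (y + z) = edot x y + edot x z.
Proof. by rewrite -big_split; apply: eq_bigr => i _; rewrite mxE mulrDr. Qed.

Lemma edotZr a x y : edot x (a *: y) = a * edot x y.
Proof. by rewrite mulr_sumr; apply: eq_bigr => i _; rewrite mxE; ring. Qed.

Lemma edotNr x y : edot x (- y) = - edot x y.
Proof. by rewrite -scaleN1r edotZr mulN1r. Qed.

Lemma edotBr x y z : edot x (y - z) = edot x y - edot x z.
Proof. by rewrite edotDr edotNr. Qed.

Lemma edotBl x y z : edot (x - y) z = edot x z - edot y z.
Proof. by rewrite edotC edotBr !(edotC z). Qed.

Lemma edotDl x y z : edot (x + y) z = edot x z + edot y z.
Proof. by rewrite edotC edotDr !(edotC z). Qed.

Lemma edotZl a x y : edot (a *: x) y = a * edot x y.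
Proof. by rewrite edotC edotZr edotC. Qed.

Lemma edot0r x : edot x 0 = 0.
Proof. by rewrite -(scale0r (0 : 'cV_d)) edotZr mul0r. Qed.

Lemma edot_sumr (J : finType) x (F : J -> 'cV[R]_d) :
  edot x (\sum_j F j) = \sum_j edot x (F j).
Proof.
by apply: (big_morph (edot x)) => [y z|]; rewrite ?edotDr ?edot0r.
Qed.

Lemma edot_ge0 x : 0 <= edot x x.
Proof. by apply: sumr_ge0 => i _; rewrite -expr2 sqr_ge0. Qed.

Lemma enorm_ge0 x : 0 <= enorm x.
Proof. exact: sqrtr_ge0. Qed.

Lemma sqr_enorm x : enorm x ^+ 2 = edot x x.
Proof. by rewrite sqr_sqrtr // edot_ge0. Qed.

Lemma edot_eq0 x : (edot x x == 0) = (x == 0).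
Proof.
apply/eqP/eqP => [/eqP|->]; last by rewrite edot0r.
rewrite psumr_eq0 => [/allP x0|i _]; last by rewrite -expr2 sqr_ge0.
apply/matrixP => i j; rewrite ord1 mxE; apply/eqP.
by have := x0 i (mem_index_enum i); rewrite mulf_eq0 orbb.
Qed.

Lemma enorm_eq0 x : (enorm x == 0) = (x == 0).
Proof. by rewrite -(sqrf_eq0 (enorm x)) sqr_enorm edot_eq0. Qed.

Lemma enorm0 : enorm (0 : 'cV[R]_d) = 0.
Proof. by apply/eqP; rewrite enorm_eq0. Qed.

Lemma enorm_gt0 x : (0 < enorm x) = (x != 0).
Proof. by rewrite lt_neqAle enorm_ge0 andbT eq_sym enorm_eq0. Qed.

Lemma enormZ a x : enorm (a *: x) = `|a| * enorm x.
Proof.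
by rewrite /enorm edotZl edotZr mulrA -expr2 sqrtrM ?sqr_ge0 // sqrtr_sqr.
Qed.

Lemma enormN x : enorm (- x) = enorm x.
Proof. by rewrite -scaleN1r enormZ normrN1 mul1r. Qed.

Lemma enormB x y : enorm (x - y) = enorm (y - x).
Proof. by rewrite -enormN opprB. Qed.

(** Cauchy-Schwarz: the squared norm of [enorm y *: x - enorm x *: y] is nonnegative and equals
    2|x||y|(|x||y| - <x,y>). *)
Lemma edot_le x y : edot x y <= enorm x * enorm y.
Proof.
have [->|x0] := eqVneq x 0; first by rewrite edotC edot0r enorm0 mul0r.
have [->|y0] := eqVneq y 0; first by rewrite edot0r enorm0 mulr0.
have p : 0 < enorm x * enorm y by rewrite mulr_gt0 ?enorm_gt0.
have := edot_ge0 (enorm y *: x - enorm x *: y).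
rewrite !(edotBl, edotBr, edotZl, edotZr) (edotC y x) -!sqr_enorm => h.
rewrite -subr_ge0 -(pmulr_rge0 _ p); nra.
Qed.

Lemma ler_norm_edot x y : `|edot x y| <= enorm x * enorm y.
Proof.
rewrite ler_norml edot_le andbT lerNl -edotNr.
by rewrite (le_trans (edot_le _ _)) // enormN.
Qed.

Lemma ler_enormD x y : enorm (x + y) <= enorm x + enorm y.
Proof.
rewrite -(@ler_pXn2r _ 2) ?nnegrE ?addr_ge0 ?enorm_ge0 //.
rewrite sqr_enorm edotDl !edotDr (edotC y x) -!sqr_enorm.
by have := edot_le x y; nra.
Qed.

Lemma ler_enormB_trans z x y : enorm (x - y) <= enorm (x - z) + enorm (z - y).
Proof. by rewrite -[x in x - y](subrK z) -addrA ler_enormD. Qed.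

Lemma ler_dist_enorm x y : `|enorm x - enorm y| <= enorm (x - y).
Proof.
have h (u v : 'cV[R]_d) : enorm u - enorm v <= enorm (u - v).
  by rewrite lerBlDr -{1}(subrK v u) ler_enormD.
by rewrite ler_norml h andbT lerNl opprB (enormB x) h.
Qed.

(** Source of the signs inside a cluster: [x] will be a diameter vector and [x + y] another
    difference of two cluster members. *)
Lemma edot_addr_le0 x y : edot (x + y) (x + y) <= edot x x -> edot x y <= 0.
Proof.
rewrite edotDl !edotDr (edotC y x); have := edot_ge0 y; lra.
Qed.

End Euclid.

(** * Behaviour of the force away from collisions and near them *)

Section Force.
Variables (R : realType) (f : R -> R).
Hypothesis hf : admissible_force f.

(** The segment from [x] to [y] may pass near 0, so the mean value theorem is applied to the radii
    only; the change of direction is absorbed by the bound on [f]. *)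
Lemma admissible_force_lipschitz (d : nat) (delta : R) : 0 < delta ->
  exists2 M : R, 0 <= M & forall x y : 'cV[R]_d,
    delta < enorm x -> delta < enorm y ->
    enorm (f (enorm x) *: x - f (enorm y) *: y) <= M * enorm (x - y).
Proof.
move=> delta0; case: hf => fc /(_ _ delta0) [fd fb _ dfb] _.
have [M1 M10 /= hM1] := ex_strict_bound_gt0 fb.
have [M2 M20 /= hM2] := ex_strict_bound_gt0 dfb.
exists (M1 + M2) => [|x y]; first by rewrite ltW // addr_gt0.
(* The intermediate point c exceeds [a], so a|f'(c)| is at most |c f'(c)|, hence at most [M2]. *)
have scal (a b : R) : delta < a -> a < b -> `|a * (f a - f b)| <= M2 * (b - a).
  move=> da ab.
  have [||c] := @MVT R f (derive1 f) a b ab.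
  - move=> z; rewrite in_itv /= => /andP[az _]; rewrite derive1E.
    by apply/derivableP/fd/(lt_trans da).
  - apply: derivable_within_continuous => z; rewrite in_itv /= => /andP[az _].
    exact/fd/(lt_le_trans da).
  rewrite in_itv /= => /andP[ac cb] E.
  have c0 : 0 < c by rewrite (lt_trans delta0) // (lt_trans da).
  have a0 : 0 < a by rewrite (lt_trans delta0).
  rewrite -opprB E mulrN normrN mulrA normrM.
  rewrite (gtr0_norm (_ : 0 < b - a)) ?subr_gt0 //.
  rewrite ler_pM2r ?subr_gt0 //.
  have := hM2 c (lt_trans da ac); rewrite !normrM (gtr0_norm c0) (gtr0_norm a0).
  by move/ltW; apply: le_trans; rewrite ler_wpM2r // ltW.
(* The vector multiplied by the difference of the values of [f] must be the shorter one, to match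
   the factor [a] in [scal]. *)
wlog xy : x y / enorm x <= enorm y.
  move=> H dx dy; have [xy|/ltW yx] := leP (enorm x) (enorm y); first exact: H.
  by rewrite [leLHS]enormB (enormB x y); exact: H.
move=> dx dy.
have -> : f (enorm x) *: x - f (enorm y) *: y =
    f (enorm y) *: (x - y) + (f (enorm x) - f (enorm y)) *: x.
  by apply/matrixP => i j; rewrite !mxE; ring.
rewrite (le_trans (ler_enormD _ _)) // !enormZ mulrDl lerD //.
  by rewrite ler_wpM2r ?enorm_ge0 // ltW // hM1.
move: xy; rewrite le_eqVlt => /predU1P[->|xy].
  by rewrite subrr normr0 mul0r mulr_ge0 ?enorm_ge0 ?ltW.
have := scal _ _ dx xy; rewrite normrM mulrC (ger0_norm (enorm_ge0 x)).
move=> /le_trans; apply; rewrite (ler_wpM2l (ltW M20)) //.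
by rewrite (enormB x y); exact: le_trans (ler_norm _) (ler_dist_enorm _ _).
Qed.

(** The sign [e] of the infinite limit lets attraction and repulsion be treated together. *)
Lemma admissible_force_blowup : exists2 e : R, `|e| = 1 &
  forall P : R, exists2 rho : R, 0 < rho &
    forall x : R, 0 < x -> x < rho -> P <= e * f x.
Proof.
have near0 (S : set R) : (\forall x \near 0^'+, S x) ->
    exists2 rho : R, 0 < rho & forall x : R, 0 < x -> x < rho -> S x.
  case=> rho /= rho0 h; exists rho => // x x0 xr; apply: h => //=.
  by rewrite sub0r normrN gtr0_norm.
case: hf => _ _ [/cvgryPge|/cvgrNyPle] h.
  exists 1 => [|P]; first by rewrite normr1.
  by have [rho rho0 H] := near0 _ (h P); exists rho => // x *; rewrite mul1r H.
exists (- 1) => [|P]; first by rewrite normrN1.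
have [rho rho0 H] := near0 _ (h (- P)); exists rho => // x x0 xr.
by rewrite mulN1r lerNr H.
Qed.

End Force.

(** * Uniform separation of configurations at a fixed instant *)

Section CentralConfigurations.
Variables (R : realType) (n d : nat) (f : R -> R) (m : 'I_n -> R).
Variables (A : 'M[R]_d) (a : R).
Hypothesis hf : admissible_force f.
Hypothesis m_gt0 : forall i, 0 < m i.
Hypothesis A_le : forall x : 'cV[R]_d, enorm (A *m x) <= a * enorm x.

Definition central_configuration (Q : 'I_n -> 'cV[R]_d) : Prop :=
  injective Q /\
  forall i, A *m Q i =
    \sum_(j < n | j != i) (m j * f (enorm (Q j - Q i))) *: (Q j - Q i).

Definition ball_indices (Q : 'I_n -> 'cV[R]_d) (i : 'I_n) (r : R) : {set 'I_n} :=
  [set j | enorm (Q j - Q i) < r]%SET.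

(** Equality of the two balls says that the shell between radii [r] and [delta] contains no body.
    The radius [r] is chosen before [Q], hence is uniform in the configuration. *)
Lemma isolated_cluster_trivial (delta : R) : 0 < delta ->
  exists2 r : R, 0 < r <= delta & forall Q i, central_configuration Q ->
    ball_indices Q i r = ball_indices Q i delta ->
    ball_indices Q i r = [set i]%SET.
Proof.
move=> delta0.
have hd0 : 0 < delta / 2 by lra.
have [M M0 lip] := admissible_force_lipschitz hf d hd0.
have [e e1 blow] := admissible_force_blowup hf.
pose Mtot := \sum_i m i.
(* [|a|] accounts for [A], [M * Mtot] for the bodies outside the cluster, and 1 makes the final
   contradiction strict. *)
pose K := `|a| + M * Mtot + 1.
have Mtot0 : 0 <= Mtot by apply: sumr_ge0 => i _; exact: ltW.
have K0 : 0 < K by rewrite ltr_wpDl // addr_ge0 // mulr_ge0.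
(* Summing over all masses gives one threshold that serves every body, without a minimal mass. *)
pose P := \sum_i K / m i.
have PK j : K <= m j * P.
  rewrite -ler_pdivrMl // mulrC /P (bigD1 j) //= lerDl.
  by apply: sumr_ge0 => i _; rewrite divr_ge0 // ltW.
have [rho rho0 hrho] := blow P.
(* [rho / 2] keeps mutual distances in the cluster below [rho]; [delta / 2] keeps the other bodies
   farther than [delta / 2] from every member. *)
pose r := Num.min (delta / 2) (rho / 2).
have r0 : 0 < r by rewrite lt_min; lra.
have r1 : r <= delta / 2 by rewrite ge_min lexx.
have r2 : r <= rho / 2 by rewrite ge_min lexx orbT.
exists r; first by rewrite r0; lra.
move=> Q i0 [Qinj Qeq] eqC; set C := ball_indices Q i0 r in eqC *.
have inC j : (j \in C) = (enorm (Q j - Q i0) < r) by rewrite inE.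
have i0C : i0 \in C by rewrite inC subrr enorm0.
pose dist (p : 'I_n * 'I_n) := enorm (Q p.1 - Q p.2).
have i00 : (i0, i0) \in finset.setX C C by rewrite finset.in_setX i0C.
(* The pair [(i, l)] realises the diameter of the cluster. *)
have [[i l] /= il_C il_max] := @Order.TotalTheory.arg_maxP _ _ _ (i0, i0)
  (fun p => p \in finset.setX C C) dist i00.
move: il_C; rewrite finset.in_setX => /andP[/= iC lC].
have {il_max}ilmax j j' : j \in C -> j' \in C ->
    enorm (Q j - Q j') <= enorm (Q i - Q l).
  by move=> jC j'C; apply: (il_max (j, j')); rewrite finset.in_setX jC.
have CC j j' : j \in C -> j' \in C -> enorm (Q j - Q j') < rho.
  rewrite !inC => hj hj'; have := ler_enormB_trans (Q i0) (Q j) (Q j').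
  by rewrite (enormB (Q i0)); lra.
have CD j j' : j \in C -> j' \notin C -> delta / 2 < enorm (Q j' - Q j).
  rewrite {2}eqC inC inE -leNgt => hj hj'.
  by have := ler_enormB_trans (Q j) (Q j') (Q i0); lra.
set u := Q i - Q l in ilmax *.
have [u0|u_neq0] := eqVneq u 0.
  apply/setP => j; rewrite finset.in_set1; apply/idP/eqP => [jC|-> //].
  apply/Qinj/eqP; rewrite -subr_eq0 -enorm_eq0 eq_le enorm_ge0 andbT.
  by rewrite (le_trans (ilmax _ _ jC i0C)) // u0 enorm0.
exfalso.
have u2 : 0 < enorm u ^+ 2 by rewrite exprn_gt0 // enorm_gt0.
pose g (x : 'cV[R]_d) := f (enorm x) *: x.
(* The self-interaction may be included in the sum, as g 0 = 0. *)
have force j : A *m Q j = \sum_j' m j' *: g (Q j' - Q j).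
  rewrite Qeq [RHS](bigD1 j) //= /g subrr !scaler0 add0r.
  by apply: eq_bigr => j' _; rewrite scalerA.
have Au : edot u (A *m u) =
    \sum_j m j * edot u (g (Q j - Q i) - g (Q j - Q l)).
  rewrite {2}/u mulmxBr !force -sumrB edot_sumr.
  by apply: eq_bigr => j _; rewrite -scalerBr edotZr.
have P0 : 0 <= P by apply: sumr_ge0 => j _; rewrite divr_ge0 // ltW.
have fge j j' : j \in C -> j' \in C -> j != j' ->
    P <= e * f (enorm (Q j - Q j')).
  move=> jC j'C jj'; apply: hrho; last exact: CC.
  by rewrite enorm_gt0 subr_eq0; apply: contra_neq jj' => /Qinj.
have sq_le j j' : j \in C -> j' \in C ->
    edot (Q j - Q j') (Q j - Q j') <= edot u u.
  by move=> jC j'C; rewrite -!sqr_enorm ler_pXn2r ?nnegrE ?enorm_ge0 // ilmax.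
(* The term [j = l] is kept exactly, since [Q l - Q i] is [- u]; the other terms only need to be
   nonpositive. *)
have inner_i j : j \in C ->
    e * edot u (g (Q j - Q i)) <= - (P * enorm u ^+ 2 * (j == l)%:R).
  move=> jC; have [->|ji] := eqVneq j i.
    have /negPf-> : i != l by apply: contra_neq u_neq0 => il; rewrite /u il subrr.
    by rewrite /g subrr scaler0 edot0r !mulr0 oppr0.
  have uw0 : edot u (Q j - Q i) <= 0.
    by apply: edot_addr_le0; rewrite addrC addrA subrK sq_le.
  have fP := fge _ _ jC iC ji.
  rewrite edotZr mulrA; apply: (@le_trans _ _ (P * edot u (Q j - Q i))).
    by rewrite ler_wnM2r.
  have [->|_] := eqVneq j l; last by rewrite mulr0 oppr0 mulr_ge0_le0.
  by rewrite mulr1 -mulrN sqr_enorm -edotNr opprB.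
have inner_l j : j \in C -> 0 <= e * edot u (g (Q j - Q l)).
  move=> jC; have [->|jl] := eqVneq j l.
    by rewrite /g subrr scaler0 edot0r !mulr0.
  have uw0 : 0 <= edot u (Q j - Q l).
    rewrite -oppr_le0 -edotNr opprB; apply: edot_addr_le0.
    by rewrite /u addrA subrK sq_le.
  by rewrite edotZr mulrA mulr_ge0 // (le_trans P0) // fge.
(* The two arguments of [g] differ by [u] up to sign, and both have norm above [delta / 2]. *)
have outer j : j \notin C ->
    e * edot u (g (Q j - Q i) - g (Q j - Q l)) <= M * enorm u ^+ 2.
  move=> jC; rewrite (le_trans (ler_norm _)) // normrM e1 mul1r.
  rewrite (le_trans (ler_norm_edot _ _)) // expr2 mulrCA.
  rewrite ler_wpM2l ?enorm_ge0 // (le_trans (lip _ _ _ _)) ?CD //.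
  by rewrite enormB opprB addrC addrA subrK.
(* One bound for all [j]: members of the cluster receive the nonnegative outer bound as slack, so
   that the sum factors through [Mtot]. *)
have term j : e * (m j * edot u (g (Q j - Q i) - g (Q j - Q l))) <=
   m j * (M * enorm u ^+ 2) - m l * P * enorm u ^+ 2 * (j == l)%:R.
  have -> : m l * P * enorm u ^+ 2 * (j == l)%:R =
      m j * (P * enorm u ^+ 2 * (j == l)%:R).
    by have [->|_] := eqVneq j l; rewrite ?mulr0 // !mulrA.
  rewrite mulrCA -mulrBr ler_wpM2l ?(ltW (m_gt0 _)) //.
  have [jC|jC] := boolP (j \in C).
    rewrite edotBr mulrBr; have := inner_i _ jC; have := inner_l _ jC.
    have : 0 <= M * enorm u ^+ 2 by rewrite mulr_ge0 // ltW.
    lra.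
  have /negPf-> : j != l by apply: contraNneq jC => ->.
  by rewrite mulr0 subr0 outer.
have upper : e * edot u (A *m u) <= (M * Mtot - m l * P) * enorm u ^+ 2.
  rewrite Au mulr_sumr (le_trans (ler_sum _ (fun j _ => term j))) //.
  rewrite sumrB -mulr_suml -mulr_sumr -/Mtot (bigD1 l) //= eqxx big1 => [|j /negPf-> //].
  by rewrite mulr1n addr0 mulr1 mulrBl mulrCA mulrA.
have lower : - (`|a| * enorm u ^+ 2) <= e * edot u (A *m u).
  have : `|e * edot u (A *m u)| <= `|a| * enorm u ^+ 2.
    rewrite normrM e1 mul1r (le_trans (ler_norm_edot _ _)) // expr2 mulrCA.
    rewrite ler_wpM2l ?enorm_ge0 // (le_trans (A_le _)) // ler_wpM2r ?enorm_ge0 //.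
    exact: ler_norm.
  by rewrite ler_norml => /andP[].
(* After division by |u|^2 the two bounds give -|a| <= M Mtot - m_l P <= -|a| - 1. *)
have := PK l; rewrite /K; nra.
Qed.

Lemma central_configuration_separated : exists2 c : R, 0 < c &
  forall Q, central_configuration Q ->
    forall i j, i != j -> c < enorm (Q i - Q j).
Proof.
(* After [s] shrinkings, either only the centre remains or at least [s] bodies lie outside the
   ball. *)
have shrink s : exists2 c : R, 0 < c & forall Q i, central_configuration Q ->
    ball_indices Q i c = [set i]%SET \/ (#|ball_indices Q i c| + s <= n)%N.
  elim: s => [|s [c c0 IH]].
    by exists 1 => // Q i _; right; rewrite addn0 -[leqRHS]card_ord max_card.
  have [r /andP[r0 rc] isolated] := isolated_cluster_trivial c0.
  exists r => // Q i HQ.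
  have [Er|Er] := eqVneq (ball_indices Q i r) (ball_indices Q i c).
    by left; apply: isolated.
  have sub : ball_indices Q i r \proper ball_indices Q i c.
    rewrite finset.properEneq Er; apply/fintype.subsetP => j.
    by rewrite !inE => /lt_le_trans; apply.
  case: (IH Q i HQ) => [Ec|le_n].
    left; apply/eqP; rewrite finset.eqEsubset -{1}Ec (proper_sub sub).
    by rewrite finset.sub1set inE subrr enorm0.
  by right; rewrite addnS (leq_trans _ le_n) // ltn_add2r proper_card.
(* With [s = n] the second alternative would make the ball empty, although it contains its
   centre. *)
have [c c0 H] := shrink n.
(* Lying outside the open ball gives only a weak inequality; halving [c] makes it strict. *)
exists (c / 2) => [|Q HQ i j ij]; first by rewrite divr_gt0.
have ball1 : ball_indices Q j c = [set j]%SET.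
  have [//|] := H Q j HQ.
  rewrite -[leqRHS]add0n leq_add2r leqn0 cards_eq0 => /eqP E.
  by have := finset.in_set0 j; rewrite -E inE subrr enorm0 c0.
have : i \notin ball_indices Q j c by rewrite ball1 finset.in_set1.
rewrite inE -leNgt; lra.
Qed.

End CentralConfigurations.

(** * Differentiation of a moving matrix times a constant one *)

Section RotatingSolutions.
Variables (R : realType) (d : nat).

(** Entrywise, the product is a finite combination of entries of [T] with constant coefficients. *)
Lemma is_derive_mulmxr (p q : nat) (T : R -> 'M[R]_(d, p))
    (B : 'M[R]_(p, q)) t dT :
  is_derive t (1 : R) T dT ->
  is_derive t (1 : R) (fun s => T s *m B) (dT *m B).
Proof.
move=> [T1 <-].
have entry i j :
    is_derive t (1 : R) (fun s => (T s *m B) i j) (('D_1 T t *m B) i j).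
  have -> : (fun s => (T s *m B) i j) = \sum_k (fun s => B k j *: T s i k).
    by apply/funext => s; rewrite fct_sumE mxE; apply: eq_bigr => k _; rewrite mulrC.
  rewrite mxE (eq_bigr (fun k => B k j *: 'D_1 (fun s => T s i k) t)).
    apply: is_derive_sum => k; apply: is_deriveZ; apply/derivableP.
    by move/derivable_mxP: T1; apply.
  by move=> k _; rewrite derive_mx // mxE mulrC.
have TB1 : derivable (fun s => T s *m B) t 1.
  by apply/derivable_mxP => i j; case: (entry i j).
apply: DeriveDef => //; rewrite derive_mx //.
by apply/matrixP => i j; rewrite mxE; case: (entry i j).
Qed.

(** The formula for the first derivative holds on [I] only; openness makes it hold near [t], so it
    can be differentiated again. *)
Lemma derive1n2_mulmxr (p q : nat) (I : set R) (T : R -> 'M[R]_(d, p))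
    (B : 'M[R]_(p, q)) t :
  open I -> twice_derivable_on I T -> I t ->
  derive1n 2 (fun s => T s *m B) t = derive1n 2 T t *m B.
Proof.
move=> I_open T2 It.
have d1 s : I s -> derive1 (fun s => T s *m B) s = derive1 T s *m B.
  move=> Is; rewrite !derive1E; have [T1 _] := T2 s Is.
  by have /is_derive_mulmxr -/(_ q B)[] := derivableP T1.
rewrite /= !(derive1E (derive1 _)).
rewrite (@near_eq_derive _ _ _ _ (fun s => derive1 T s *m B)).
  have [_ dT1] := T2 t It.
  by have /is_derive_mulmxr -/(_ q B)[] := derivableP dT1.
by near=> s; apply: d1; near: s; exact: open_nbhs_nbhs.
Unshelve. all: by end_near.
Qed.

End RotatingSolutions.

(** * Reduction of relative equilibria to configurations at one instant *)

Theorem theorem1p4 (R : realType) (n k : nat) (hn : (2 <= n)%N)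
  (hk : (1 <= k)%N) (f : R -> R) (hf : admissible_force f)
  (m : 'I_n -> R) (hm : forall i, 0 < m i)
  (I : set R) (hI : open_time_interval I)
  (T : R -> 'M[R]_k.+1) (hT : admissible_rotation I T) :
  exists c : R, 0 < c /\
    forall Q : 'I_n -> 'cV[R]_k.+1,
      relative_equilibria f m I T (fun i t => T t *m Q i) ->
      forall i j : 'I_n, i != j -> c < enorm (Q i - Q j).
Proof.
case: hI => I_open _ [t It]; case: hT => T2 Tunit Tiso [c1 [c2 [_ _ TA]]].
pose A := invmx (T t) *m derive1n 2 T t.
have A_le (x : 'cV[R]_k.+1) : enorm (A *m x) <= c2 * enorm x.
  by have /andP[] := TA t It x.
have [c c0 H] := central_configuration_separated hf hm A_le.
exists c; split=> // Q [[Qneq _ Qeq] _]; apply: H.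
have enormT (x : 'cV[R]_k.+1) : enorm (T t *m x) = enorm x by rewrite /enorm Tiso.
split=> [i j Qij|i].
  by apply/eqP/negPn/negP => /(Qneq t It i j)/eqP; rewrite Qij.
(* Multiplying by the inverse of [T t] cancels the rotation on the right-hand side, and the isometry
   property turns the distances into those between the [Q i]. *)
have := Qeq t It i; rewrite (derive1n2_mulmxr _ I_open T2 It) /A -mulmxA => ->.
rewrite mulmx_sumr; apply: eq_bigr => j _.
by rewrite -mulmxBr enormT -scalemxAr mulKmx // Tunit.
Qed.
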